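(* Let $q=p^h\geq 5$ be a prime power ($p$ prime, $h$ a positive integer). Let $1\leq e,e'\leq h-1$ be integers such that $e=\gcd(e',h)$ and $\frac{h}{e}$ is even. Let $a_1,\dots,a_n$ be distinct elements of $\mathbb{F}_q$, $\boldsymbol{a}=(a_1,\dots,a_n)$, $\boldsymbol{v}=(v_1,\dots,v_n)\in(\mathbb{F}_q^* )^n$, and $u_i=\prod_{1\leq j\leq n,\,j\neq i}(a_i-a_j)^{-1}$ for $1\leq i\leq n$. Then the following hold. 1) Suppose that $\mathrm{GRS}_m(\boldsymbol{a},\boldsymbol{v})\subseteq \mathrm{GRS}_m(\boldsymbol{a},\boldsymbol{v})^{\bot_e}$, and let $h(x)\in\mathbb{F}_q[x]$ be a monic polynomial with $\deg(h(x))\leq n-m-1$ such that, for some $\lambda\in\mathbb{F}_q^*$, $\lambda u_i h(a_i)=v_i^{p^e+1}$ for all $1\leq i\leq n$ (such a polynomial exists because of the self-orthogonality). Then for every integer $k$ with $1\leq k\leq \left\lfloor \frac{p^{e'}+n-1-\deg(h(x))}{p^{e'}+1}\right\rfloor$ and every integer $l$ with $0\leq l\leq k$, there exists an $[n,k]_q$ MDS code $\mathcal{C}$ with $\dim(\mathrm{Hull}_{e'}(\mathcal{C}))=l$. 2) Suppose that $\mathrm{GRS}_m(\boldsymbol{a},\boldsymbol{v},\infty)\subseteq \mathrm{GRS}_m(\boldsymbol{a},\boldsymbol{v},\infty)^{\bot_e}$ with $m\geq 2$, and let $h(x)\in\mathbb{F}_q[x]$ be a monic polynomial with $\deg(h(x))\leq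 n-m-1$ such that, for some $\lambda\in\mathbb{F}_q^*$, $\lambda u_i h(a_i)=v_i^{p^e+1}$ for all $1\leq i\leq n$ (such a polynomial exists because of the self-orthogonality). Then for every integer $k$ with $1\leq k\leq \left\lfloor \frac{p^{e'}+n-1-\deg(h(x))}{p^{e'}+1}\right\rfloor$ and every integer $l$ with $0\leq l\leq k-1$, there exists an $[n+1,k]_q$ MDS code $\mathcal{C}$ with $\dim(\mathrm{Hull}_{e'}(\mathcal{C}))=l$.
   Context: For $q=p^h$ and an integer $0\leq e\leq h-1$, the $e$-Galois inner product of $\mathbf{c}_1=(c_{11},\dots,c_{1N})$ and $\mathbf{c}_2=(c_{21},\dots,c_{2N})$ in $\mathbb{F}_q^N$ is $(\mathbf{c}_1,\mathbf{c}_2)_e=\sum_{i=1}^N c_{1i}c_{2i}^{p^e}$. For a linear code $\mathcal{C}\subseteq\mathbb{F}_q^N$, its $e$-Galois dual is $\mathcal{C}^{\bot_e}=\{\mathbf{c}_1\in\mathbb{F}_q^N:(\mathbf{c}_1,\mathbf{c}_2)_e=0\text{ for all }\mathbf{c}_2\in\mathcal{C}\}$, and its $e$-Galois hull is $\mathrm{Hull}_e(\mathcal{C})=\mathcal{C}\cap\mathcal{C}^{\bot_e}$. An $[N,k]_q$ code is a $k$-dimensional linear subspace of $\mathbb{F}_q^N$; it is MDS if its minimum Hamming distance is $N-k+1$. For distinct $a_1,\dots,a_n\in\mathbb{F}_q$, $\boldsymbol{v}\in(\mathbb{F}_q^* )^n$ and an integer $k\geq 0$: $\mathrm{GRS}_k(\boldsymbol{a},\boldsymbol{v})=\{(v_1f(a_1),\dots,v_nf(a_n)):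 f(x)\in\mathbb{F}_q[x],\ \deg(f(x))\leq k-1\}$ and $\mathrm{GRS}_k(\boldsymbol{a},\boldsymbol{v},\infty)=\{(v_1f(a_1),\dots,v_nf(a_n),f_{k-1}): f(x)\in\mathbb{F}_q[x],\ \deg(f(x))\leq k-1\}$, where $f_{k-1}$ is the coefficient of $x^{k-1}$ in $f(x)$. The polynomial $h(x)$ is unrelated to the exponent $h$ in $q=p^h$. *)

(* Defs.v *)
From HB Require Import structures.
From mathcomp Require Import all_boot all_order all_algebra all_field.

Set Implicit Arguments.
Unset Strict Implicit.
Unset Printing Implicit Defensive.

Import GRing.Theory.
Local Open Scope ring_scope.

Definition galois_inner (F : finFieldType) (p e N : nat) (c1 c2 : 'rV[F]_N) : F :=
  \sum_(i < N) c1 0 i * c2 0 i ^+ (p ^ e).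

(* [linfun] is only meaningful on linear functions: the form is linear in its
   first argument, whatever [p] and [e] are. *)
Lemma galois_inner_is_linear (F : finFieldType) (p e N : nat) (c2 : 'rV[F]_N) :
  linear ((@galois_inner F p e N)^~ c2 : 'rV[F]_N -> F^o).
Proof.
move=> x c1 c1'; rewrite /galois_inner scaler_sumr -big_split /=.
by apply: eq_bigr => i _; rewrite !mxE mulrDl scalerAl.
Qed.

Definition galois_dual (F : finFieldType) (p e N : nat) (C : {vspace 'rV[F]_N}) :
    {vspace 'rV[F]_N} :=
  (\bigcap_(c2 : 'rV[F]_N | c2 \in C)
     lker (linfun ((@galois_inner F p e N)^~ c2 : 'rV[F]_N -> F^o)))%VS.

Lemma galois_dualP (F : finFieldType) (p e N : nat) (C : {vspace 'rV[F]_N})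
    (c1 : 'rV[F]_N) :
  reflect (forall c2, c2 \in C -> galois_inner p e c1 c2 = 0)
          (c1 \in galois_dual p e C).
Proof.
have kerE c2 :
    (c1 \in lker (linfun ((@galois_inner F p e N)^~ c2 : 'rV[F]_N -> F^o)))
    = (galois_inner p e c1 c2 == 0).
  pose linI := GRing.isLinear.Build _ _ _ _ _ (@galois_inner_is_linear F p e N c2).
  pose f : {linear 'rV[F]_N -> F^o} := HB.pack ((@galois_inner F p e N)^~ c2) linI.
  by rewrite memv_ker (lfunE f).
rewrite /galois_dual memvE.
apply: (iffP subv_bigcapP) => [sub c2 Cc2 | ort c2 Cc2].
  by apply/eqP; rewrite -kerE memvE sub.
by rewrite -memvE kerE ort.
Qed.

Definition galois_hull (F : finFieldType) (p e N : nat) (C : {vspace 'rV[F]_N}) :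
    {vspace 'rV[F]_N} :=
  (C :&: galois_dual p e C)%VS.

Definition hamming_dist (F : finFieldType) (N : nat) (c1 c2 : 'rV[F]_N) : nat :=
  #|[set i | c1 0 i != c2 0 i]|.

(* A relation rather than a function: the zero code has no minimum distance. *)
Definition is_min_dist (F : finFieldType) (N : nat) (C : {vspace 'rV[F]_N})
    (d : nat) : Prop :=
  (exists c1 c2, [/\ c1 \in C, c2 \in C, c1 != c2 & hamming_dist c1 c2 = d]) /\
  (forall c1 c2, c1 \in C -> c2 \in C -> c1 != c2 -> (d <= hamming_dist c1 c2)%N).

(* The subtraction never truncates, since [\dim C <= N]. *)
Definition is_MDS (F : finFieldType) (N : nat) (C : {vspace 'rV[F]_N}) : Prop :=
  is_min_dist C (N - \dim C + 1).

Definition grs_word (F : finFieldType) (n : nat) (a v : 'I_n -> F) (f : {poly F}) :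
    'rV[F]_n :=
  \row_i (v i * f.[a i]).

Definition grs_inf_word (F : finFieldType) (n k : nat) (a v : 'I_n -> F)
    (f : {poly F}) : 'rV[F]_(n + 1) :=
  row_mx (grs_word a v f) (const_mx f`_k.-1).

Lemma grs_word_is_linear (F : finFieldType) (n : nat) (a v : 'I_n -> F) :
  linear (grs_word a v).
Proof.
move=> x f g; apply/rowP => i.
by rewrite !mxE hornerD hornerZ mulrDr mulrCA.
Qed.

Lemma grs_inf_word_is_linear (F : finFieldType) (n k : nat) (a v : 'I_n -> F) :
  linear (grs_inf_word k a v).
Proof.
move=> x f g; rewrite /grs_inf_word grs_word_is_linear scale_row_mx add_row_mx.
by congr row_mx; apply/rowP => i; rewrite !mxE coefD coefZ.
Qed.

(* [{poly_k F}] is the space of polynomials of size at most [k], that is of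
   degree at most [k - 1]. *)
Definition GRS (F : finFieldType) (n k : nat) (a v : 'I_n -> F) :
    {vspace 'rV[F]_n} :=
  limg (linfun (fun f : {poly_k F} => grs_word a v f)).

Definition GRS_inf (F : finFieldType) (n k : nat) (a v : 'I_n -> F) :
    {vspace 'rV[F]_(n + 1)} :=
  limg (linfun (fun f : {poly_k F} => grs_inf_word k a v f)).

Lemma limg_npolyP (F : finFieldType) (N k : nat) (w : {poly F} -> 'rV[F]_N)
    (w_lin : linear w) (c : 'rV[F]_N) :
  reflect (exists2 f : {poly F}, (size f <= k)%N & c = w f)
          (c \in limg (linfun (fun f : {poly_k F} => w f))).
Proof.
have w'_lin : linear (fun f : {poly_k F} => w f) by move=> x f g; rewrite -w_lin.
pose linI := GRing.isLinear.Build _ _ _ _ _ w'_lin.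
pose u : {linear {poly_k F} -> 'rV[F]_N} :=
  HB.pack (fun f : {poly_k F} => w f) linI.
apply: (iffP memv_imgP) => [[f _ ->] | [f le_fk ->]].
  by exists f; [exact: size_npoly | rewrite (lfunE u)].
have f_in : f \is a poly_of_size k by rewrite qualifE.
by exists (NPoly f_in); [exact: memvf | rewrite (lfunE u)].
Qed.

Lemma GRSP (F : finFieldType) (n k : nat) (a v : 'I_n -> F) (c : 'rV[F]_n) :
  reflect (exists2 f : {poly F}, (size f <= k)%N & c = grs_word a v f)
          (c \in GRS k a v).
Proof. exact: (limg_npolyP k (@grs_word_is_linear F n a v)). Qed.

Lemma GRS_infP (F : finFieldType) (n k : nat) (a v : 'I_n -> F)
    (c : 'rV[F]_(n + 1)) :
  reflect (exists2 f : {poly F}, (size f <= k)%N & c = grs_inf_word k a v f)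
          (c \in GRS_inf k a v).
Proof. exact: (limg_npolyP k (@grs_inf_word_is_linear F n k a v)). Qed.

Definition grs_u (F : finFieldType) (n : nat) (a : 'I_n -> F) (i : 'I_n) : F :=
  \prod_(j < n | j != i) (a i - a j)^-1.

(* As [g] is monic, its degree is [(size g).-1]; the bound
   [deg g <= n - m - 1] over the integers is written without subtraction, as a
   truncated one would admit constants when [n <= m]. *)
Definition admissible_poly (F : finFieldType) (p e n m : nat) (a v : 'I_n -> F)
    (g : {poly F}) : Prop :=
  [/\ g \is monic,
      ((size g).-1 + m + 1 <= n)%N &
      exists2 lambda : F, lambda != 0 &
        forall i, lambda * grs_u a i * g.[a i] = v i ^+ (p ^ e + 1)].

(* Main.v *)
(* Since [e = gcd (e', h)] and [h / e] is even, [gcd (p^e' + 1, q - 1)] divides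
   [p^e + 1]; hence every [v_i^(p^e + 1)] is also some [w_i^(p^e' + 1)], and, as
   [q >= 5], some nonzero [alpha] satisfies [alpha^(p^e' + 1) <> 1].  Writing
   [w_i^(p^e' + 1) = lambda u_i g(a_i)], the product of two codewords of
   [GRS_k(a, w)] is [lambda] times the coefficient of [x^(n-1)] in
   [g f1 f2^(p^e')], whose degree is at most [n - 2] by the bound on [k].
   Multiplying [w] by [alpha] on a set [S] of positions, the product becomes
   [(alpha^(p^e' + 1) - 1) * sum_(i in S) w_i^(p^e' + 1) f1(a_i) f2(a_i)^(p^e')],
   plus the product of the last coordinates in the extended case.  When
   [#|S| <= k] (resp. [#|S| <= k - 1]), testing against the [f2] that vanish at
   all but one point of [S] shows that the hull consists of the multiples of
   [prod_(i in S) (X - a_i)] (resp. those of degree at most [k - 2]). *)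
Require Import Defs.
From HB Require Import structures.
From mathcomp Require Import all_boot all_order all_algebra all_field.
From mathcomp Require Import zify.

Set Implicit Arguments.
Unset Strict Implicit.
Unset Printing Implicit Defensive.

Import GRing.Theory.
Local Open Scope ring_scope.

(** * Divisibility between the numbers p^e' + 1, p^e + 1 and p^h - 1 *)

(** Modulo [d], p^e' is -1, so both p^(2e') and p^h are 1. Writing h = 2er and e' = te with t
    coprime to 2r gives gcd(2e', h) = 2e, hence p^(2e) = 1 by Bezout. As t is odd, p^e' = p^e modulo
    [d]. *)
Lemma dvdn_expDn1_gcd (p h e e' d : nat) :
  (0 < p)%N -> (0 < e')%N -> e = gcdn e' h -> ~~ odd (h %/ e) ->
  (d %| p ^ e' + 1)%N -> (d %| p ^ h - 1)%N -> (d %| p ^ e + 1)%N.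
Proof.
move=> p_gt0 e'_gt0 e_def he_even dvd_e' dvd_h.
have e_gt0 : (0 < e)%N by rewrite e_def gcdn_gt0 e'_gt0.
have [r h_def] : exists r, h = (2 * e * r)%N.
  exists (h %/ e)./2; rewrite mulnAC mul2n.
  by rewrite even_halfK // divnK // e_def dvdn_gcdr.
have [t e'_def] : exists t, e' = (t * e)%N.
  by apply/dvdnP; rewrite e_def dvdn_gcdl.
have co_t : coprime t (2 * r).
  rewrite /coprime -(eqn_pmul2r e_gt0) mul1n muln_gcdl.
  by rewrite mulnAC -h_def -e'_def -e_def.
have t_odd : odd t.
  by move: co_t; rewrite coprimeMr coprimen2 => /andP[].
have pow_h : p ^ h = 1 %[mod d].
  by apply/eqP; rewrite eqn_mod_dvd ?expn_gt0 ?p_gt0.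
have pow1 x c : x = 1 %[mod d] -> x ^ c = 1 %[mod d].
  by move=> x1; rewrite -modnXm x1 modnXm exp1n.
have pow_2e' : p ^ (e' * 2) = 1 %[mod d].
  apply/eqP; rewrite eqn_mod_dvd ?expn_gt0 ?p_gt0 //.
  by rewrite expnM -(exp1n 2) subn_sqr dvdn_mull.
have pow_2e : p ^ (2 * e) = 1 %[mod d].
  have e'2_gt0 : (0 < e' * 2)%N by rewrite muln_gt0 e'_gt0.
  have [km kn bez _] := egcdnP h e'2_gt0.
  have gcd2e : gcdn (e' * 2) h = (2 * e)%N.
    rewrite h_def e'_def -mulnA [(e * 2)%N]mulnC [(t * _)%N]mulnC -muln_gcdr.
    by move: co_t; rewrite coprimeMr => /andP[_ /eqP->]; rewrite muln1.
  have := pow1 _ km pow_2e'; rewrite -expnM [(_ * km)%N]mulnC bez gcd2e expnD.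
  by rewrite -modnMml [(kn * h)%N]mulnC expnM (pow1 _ _ pow_h) modnMml mul1n.
have pow_e' : p ^ e' = p ^ e %[mod d].
  rewrite e'_def -[t]odd_double_half t_odd -muln2 mulnDl mul1n expnD -mulnA.
  by rewrite [(t./2 * _)%N]mulnC expnM -modnMmr (pow1 _ _ pow_2e) modnMmr muln1.
by move: dvd_e'; rewrite /dvdn -modnDml pow_e' modnDml.
Qed.

(** * Dimension, minimum distance and hull of codes parametrised by polynomials *)

Section PolynomialCodes.
Variables (F : finFieldType) (N : nat) (w : {poly F} -> 'rV[F]_N).
Hypothesis w_lin : linear w.

Lemma dim_limg_npoly k :
  (forall f : {poly F}, (size f <= k)%N -> w f = 0 -> f = 0) ->
  \dim (limg (linfun (fun f : {poly_k F} => w f))) = k.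
Proof.
move=> w_inj.
have w'_lin : linear (fun f : {poly_k F} => w f) by move=> x f g; rewrite -w_lin.
pose linI := GRing.isLinear.Build _ _ _ _ _ w'_lin.
pose u : {linear {poly_k F} -> 'rV[F]_N} :=
  HB.pack (fun f : {poly_k F} => w f) linI.
rewrite limg_dim_eq ?dim_polyn //.
apply/eqP; rewrite -subv0; apply/subvP => f; rewrite memv_cap memv_ker.
rewrite (lfunE u) /= => /andP[_ /eqP wf0]; rewrite memv0; apply/eqP/val_inj.
exact: w_inj (size_npoly f) wf0.
Qed.

(** By linearity the distance between [w f] and [w g] is [N] minus the number of zeros of
    [w (f - g)]. The bound on zeros gives distance at least N - k + 1 and also injectivity; the last
    hypothesis provides a word attaining this distance. *)
Lemma MDS_limg_npoly k :
  (0 < k <= N)%N ->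
  (forall f : {poly F}, (size f <= k)%N -> f != 0 -> (#|[set i | w f 0%R i == 0%R]| < k)%N) ->
  (exists f : {poly F}, [/\ (size f <= k)%N, f != 0 &
                 (k <= #|[set i | w f 0%R i == 0%R]| + 1)%N]) ->
  is_MDS (limg (linfun (fun f : {poly_k F} => w f))).
Proof.
move=> /andP[k_gt0 k_le] few_zeros [f0 [size_f0 f0_neq0 zeros_f0]].
have w0 : w 0 = 0 by have /(_ (-1) 0 0) := w_lin; rewrite !scaleN1r !addNr.
have wB f g : w (f - g) = w f - w g.
  by rewrite -scaleN1r addrC w_lin scaleN1r addrC.
have card_supp (c : 'rV[F]_N) :
    #|[set i | c 0%R i != 0%R]| = (N - #|[set i | c 0%R i == 0%R]|)%N.
  have cardN := cardsC [set i | c 0%R i == 0%R]; rewrite card_ord in cardN.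
  by rewrite -[X in (X - _)%N]cardN addKn; apply: eq_card => i; rewrite !inE.
have distE f g :
    hamming_dist (w f) (w g) = (N - #|[set i | w (f - g)%R 0%R i == 0%R]|)%N.
  rewrite /hamming_dist -card_supp; apply: eq_card => i.
  by rewrite !inE wB !mxE subr_eq0.
rewrite /is_MDS dim_limg_npoly; last first.
  (* A nonzero [f] with [w f = 0] would give [N >= k] zero coordinates. *)
  move=> f size_f wf0; apply/eqP/negP => /negP /(few_zeros f size_f).
  rewrite wf0 (_ : [set i | _] = setT) ?cardsT ?card_ord; first by lia.
  by apply/setP => i; rewrite !inE mxE eqxx.
split=> [|_ _ /(limg_npolyP _ w_lin)[f size_f ->]
             /(limg_npolyP _ w_lin)[g size_g ->] neq].
  have lt_k := few_zeros f0 size_f0 f0_neq0.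
  exists (w f0), (w 0); split.
  - by apply/(limg_npolyP _ w_lin); exists f0.
  - by apply/(limg_npolyP _ w_lin); exists 0; rewrite ?size_poly0.
  - apply/negP => /eqP; rewrite w0 => wf0; move: lt_k.
    rewrite wf0 (_ : [set i | _] = setT) ?cardsT ?card_ord; first by lia.
    by apply/setP => i; rewrite !inE mxE eqxx.
  - by rewrite distE subr0; lia.
rewrite distE; have := few_zeros (f - g)%R.
have -> : (size (f - g)%R <= k)%N.
  by rewrite (leq_trans (size_polyD _ _)) // size_polyN geq_max size_f.
have -> : f - g != 0 by apply: contra_neq neq => /eqP; rewrite subr_eq0 => /eqP->.
by move=> /(_ isT isT); lia.
Qed.

End PolynomialCodes.

(** Multiplication by [D] carries the polynomials of size at most [l] onto the multiples of [D] of
    size at most [K], so the hull is again the image of a polynomial space. [K] is [k] for the plain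
    codes and [k - 1] for the extended ones, whose hull loses the top coefficient. *)
Lemma dim_galois_hull (F : finFieldType) (p e N k K l : nat)
    (w : {poly F} -> 'rV[F]_N) (D : {poly F}) :
  linear w -> D \is monic -> (size D + l = K.+1)%N -> (K <= k)%N ->
  (forall f : {poly F}, (size f <= k)%N -> w f = 0 -> f = 0) ->
  (forall f1 : {poly F}, (size f1 <= k)%N ->
     (forall f2 : {poly F}, (size f2 <= k)%N -> galois_inner p e (w f1) (w f2) = 0) <->
     (D %| f1) && (size f1 <= K)%N) ->
  \dim (galois_hull p e (limg (linfun (fun f : {poly_k F} => w f)))) = l.
Proof.
move=> w_lin D_monic sizeD le_Kk w_inj hullP.
have D_neq0 := monic_neq0 D_monic.
have wD_lin : linear (fun f => w (D * f)).
  by move=> x f g; rewrite -w_lin mulrDr scalerAr.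
have size_D (f : {poly F}) : (size (D * f)%R <= K)%N = (size f <= l)%N.
  have [->|f_neq0] := eqVneq f 0; first by rewrite mulr0 size_poly0.
  have := size_poly_gt0 f; have := size_poly_gt0 D.
  rewrite f_neq0 D_neq0 size_mul //; move: sizeD.
  move: (size D) (size f) => x y. lia.
rewrite -(dim_limg_npoly (k := l) wD_lin); last first.
  move=> f size_f /w_inj; rewrite (leq_trans _ le_Kk) ?size_D // => /(_ isT).
  by move/eqP; rewrite mulf_eq0 (negPf D_neq0) => /eqP.
congr (\dim _); apply/vspaceP => c; rewrite memv_cap.
apply/andP/(limg_npolyP l wD_lin) => [[]|[f size_f ->]].
  move=> /(limg_npolyP _ w_lin)[f1 size_f1 ->] /galois_dualP orth.
  have /andP[/dvdpP[f def_f] le_f1] : (D %| f1) && (size f1 <= K)%N.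
    apply/(hullP f1 size_f1) => f2 size_f2; apply: orth.
    by apply/(limg_npolyP _ w_lin); exists f2.
  by exists f; rewrite -?size_D mulrC -def_f.
have size_Df : (size (D * f)%R <= k)%N by rewrite (leq_trans _ le_Kk) ?size_D.
split; first by apply/(limg_npolyP _ w_lin); exists (D * f).
apply/galois_dualP => _ /(limg_npolyP _ w_lin)[f2 size_f2 ->].
by apply: (proj2 (hullP _ size_Df)); rewrite ?size_D // dvdp_mulr ?dvdpp.
Qed.

(** * Vanishing polynomials and Lagrange interpolation at distinct points *)

Section Evaluation.
Variables (F : finFieldType) (n : nat) (a : 'I_n -> F).

Definition vanishing_poly (S : {set 'I_n}) : {poly F} :=
  \prod_(i in S) ('X - (a i)%:P).

Lemma vanishing_poly_monic S : vanishing_poly S \is monic.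
Proof. exact: monic_prod_XsubC. Qed.

Lemma size_vanishing_poly S : size (vanishing_poly S) = #|S|.+1.
Proof. by rewrite /vanishing_poly -big_enum size_prod_XsubC -cardE. Qed.

Lemma size_vanishing_polyC1 i : size (vanishing_poly [set~ i]) = n.
Proof. by rewrite size_vanishing_poly cardsC1 card_ord (ltn_predK (ltn_ord i)). Qed.

Hypothesis a_inj : injective a.

Lemma vanishing_poly_eq0 (S : {set 'I_n}) j : ((vanishing_poly S).[a j] == 0) = (j \in S).
Proof.
rewrite horner_prod; apply/prodf_eq0/idP => [[i iS]|jS].
  by rewrite hornerXsubC subr_eq0 => /eqP/a_inj->.
by exists j => //; rewrite hornerXsubC subrr.
Qed.

Lemma dvd_vanishing_poly (S : {set 'I_n}) (f : {poly F}) :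
  reflect (forall i, i \in S -> f.[a i] = 0) (vanishing_poly S %| f).
Proof.
apply: (iffP idP) => [/dvdpP[g ->] i iS | rootS].
  rewrite hornerM; have := vanishing_poly_eq0 S i.
  by rewrite iS => /eqP->; rewrite mulr0.
have [] := @uniq_roots_prod_XsubC _ f [seq a i | i <- enum S].
- by apply/allP => _ /mapP[i iS ->]; apply/rootP/rootS; rewrite mem_enum in iS.
- by rewrite uniq_rootsE map_inj_uniq ?enum_uniq.
by move=> g ->; rewrite big_map big_enum dvdp_mull ?dvdpp.
Qed.

Lemma card_zeros_lt (f : {poly F}) :
  f != 0 -> (#|[set i | f.[a i] == 0%R]| < size f)%N.
Proof.
move=> f_neq0; set S := [set _ | _].
have : vanishing_poly S %| f.
  by apply/dvd_vanishing_poly => i; rewrite inE => /eqP.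
by move/(dvdp_leq f_neq0); rewrite size_vanishing_poly.
Qed.

Lemma lagrange_interpolation (c : 'I_n -> F) :
  exists2 f : {poly F}, (size f <= n)%N & forall i, f.[a i] = c i.
Proof.
pose L i := vanishing_poly [set~ i].
exists (\sum_i (c i / (L i).[a i]) *: L i).
  apply: (leq_trans (size_sum _ _ _)); apply/bigmax_leqP => i _.
  apply: (leq_trans (size_scale_leq _ _)).
  by rewrite size_vanishing_polyC1.
move=> i; rewrite horner_sum (bigD1 i) //= big1 ?addr0 => [|j ji].
  by rewrite hornerZ divfK // vanishing_poly_eq0 !inE eqxx.
rewrite hornerZ; apply/eqP; rewrite mulf_eq0 vanishing_poly_eq0 !inE.
by rewrite [i == j]eq_sym ji orbT.
Qed.

(** This recognises u_i as the normalising factor of the i-th Lagrange basis polynomial. *)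
Lemma grs_uE i : grs_u a i = ((vanishing_poly [set~ i]).[a i])^-1.
Proof.
rewrite /grs_u prodfV horner_prod; congr (_^-1); apply: eq_big => j.
  by rewrite !inE.
by rewrite hornerXsubC.
Qed.

Lemma grs_u_neq0 i : grs_u a i != 0.
Proof. by rewrite grs_uE invr_eq0 vanishing_poly_eq0 !inE eqxx. Qed.

(* Compare the leading terms in the Lagrange interpolation formula. *)
Lemma sum_grs_u (f : {poly F}) :
  (size f <= n)%N -> \sum_i grs_u a i * f.[a i] = f`_n.-1.
Proof.
move=> size_f; pose L i := vanishing_poly [set~ i].
have size_L i : size (L i) = n := size_vanishing_polyC1 i.
pose f' := \sum_i (grs_u a i * f.[a i]) *: L i.
have size_f' : (size f' <= n)%N.
  apply: (leq_trans (size_sum _ _ _)); apply/bigmax_leqP => i _.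
  by apply: (leq_trans (size_scale_leq _ _)); rewrite size_L.
have f'_a j : f'.[a j] = f.[a j].
  rewrite horner_sum (bigD1 j) //= big1 ?addr0 => [|i ij].
    by rewrite hornerZ grs_uE mulrAC mulVf ?mul1r // vanishing_poly_eq0 !inE eqxx.
  rewrite hornerZ; apply/eqP; rewrite mulf_eq0 vanishing_poly_eq0 !inE.
  by rewrite [j == i]eq_sym ij orbT.
(* Both polynomials have size at most [n] and they agree at [n] distinct points. *)
have -> : f = f'.
  apply/eqP; rewrite -subr_eq0; apply: contraT => /card_zeros_lt.
  rewrite (_ : [set i | _] = setT); last first.
    by apply/setP => i; rewrite !inE hornerD hornerN f'_a subrr eqxx.
  rewrite cardsT card_ord ltnNge; case/negP.
  by rewrite (leq_trans (size_polyD _ _)) // size_polyN geq_max size_f.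
rewrite coef_sum; apply: eq_bigr => i _; rewrite f'_a coefZ -[in n.-1](size_L i).
have /monicP := vanishing_poly_monic [set~ i]; rewrite lead_coefE => ->.
by rewrite mulr1.
Qed.

(** Take the interpolant G of v_i^(p^e + 1) / u_i, made monic; its leading coefficient is [lambda].
    If deg G exceeded n - m - 1, then j = n - size G would be less than [m], and by [sum_grs_u] the
    j-th orthogonality sum would equal the leading coefficient of G x^j, which is nonzero. *)
Lemma exists_admissible_poly (p e m : nat) (v : 'I_n -> F) :
  (0 < n)%N -> (forall i, v i != 0) ->
  (forall j, (j < m)%N -> \sum_i v i ^+ (p ^ e + 1) * a i ^+ j = 0) ->
  exists g, admissible_poly p e m a v g.
Proof.
move=> n_gt0 v_neq0 orth.
have [G size_G G_a] :=
  lagrange_interpolation (fun i => v i ^+ (p ^ e + 1) / grs_u a i).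
have uG i : grs_u a i * G.[a i] = v i ^+ (p ^ e + 1).
  by rewrite G_a mulrC divfK ?grs_u_neq0.
have G_neq0 : G != 0.
  apply/eqP => G0; have := uG (Ordinal n_gt0); rewrite G0 horner0 mulr0.
  by move/esym/eqP; rewrite expf_eq0 (negPf (v_neq0 _)) andbF.
have lcG_neq0 : lead_coef G != 0 by rewrite lead_coef_eq0.
have size_G_gt0 : (0 < size G)%N by rewrite size_poly_gt0.
exists ((lead_coef G)^-1 *: G); split.
- by apply/monicP; rewrite lead_coefZ mulVf.
- rewrite size_scale ?invr_eq0 // leqNgt; apply/negP => lt_n.
  pose j := (n - size G)%N.
  have /orth : (j < m)%N by move: size_G_gt0 size_G lt_n; rewrite /j; move: (size G) => s; lia.
  under eq_bigr => i _ do rewrite -uG -mulrA -[a i ^+ j]hornerXn -hornerM.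
  have size_GX : size (G * 'X^j) = n by rewrite size_mulXn // subnK.
  rewrite sum_grs_u ?size_GX // -[in n.-1]size_GX -lead_coefE.
  move/eqP; rewrite lead_coef_eq0 mulf_eq0 (negPf G_neq0) -size_poly_eq0.
  by rewrite size_polyXn.
- exists (lead_coef G) => // i.
  by rewrite hornerZ mulrACA mulfV // mul1r uG.
Qed.

(** * Galois inner products of codewords and their change under twisting *)

Lemma galois_inner_grs (p e : nat) (v : 'I_n -> F) f1 f2 :
  galois_inner p e (grs_word a v f1) (grs_word a v f2) =
  \sum_i v i ^+ (p ^ e + 1) * (f1 * f2 ^+ (p ^ e)).[a i].
Proof.
apply: eq_bigr => i _; rewrite !mxE hornerM horner_exp exprMn addn1 exprS.
by rewrite mulrACA.
Qed.

Lemma galois_inner_grs_inf (p e k : nat) (v : 'I_n -> F) f1 f2 :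
  galois_inner p e (grs_inf_word k a v f1) (grs_inf_word k a v f2) =
  \sum_i v i ^+ (p ^ e + 1) * (f1 * f2 ^+ (p ^ e)).[a i] +
  f1`_k.-1 * f2`_k.-1 ^+ (p ^ e).
Proof.
rewrite -galois_inner_grs /galois_inner big_split_ord /= big_ord1; congr (_ + _).
  by apply: eq_bigr => i _; rewrite !row_mxEl.
by rewrite !row_mxEr !mxE.
Qed.

Lemma sum_admissible_eq0 (p e Q m k : nat) (v : 'I_n -> F) (g f1 f2 : {poly F}) :
  admissible_poly p e m a v g ->
  ((size g).-1 + (k - 1) * (Q + 1) + 2 <= n)%N ->
  (size f1 <= k)%N -> (size f2 <= k)%N ->
  \sum_i v i ^+ (p ^ e + 1) * (f1 * f2 ^+ Q).[a i] = 0.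
Proof.
move=> [_ _ [lambda _ v_g]] le_n size_f1 size_f2.
under eq_bigr => i _ do rewrite -v_g -!mulrA -hornerM.
rewrite -mulr_sumr.
(* The degree is at most deg g + (k - 1)(Q + 1) <= n - 2, so the coefficient of x^(n-1) read off by
   [sum_grs_u] is a default zero. *)
have size_gf : (size (g * (f1 * f2 ^+ Q))%R <= n.-1)%N.
  have H1 := size_polyMleq g (f1 * f2 ^+ Q).
  have H2 := size_polyMleq f1 (f2 ^+ Q).
  have H3 := size_poly_exp_leq f2 Q.
  have H4 : ((size f2).-1 * Q <= (k - 1) * Q)%N by rewrite leq_mul2r; lia.
  rewrite mulnDr muln1 in le_n.
  move: size_f1 size_f2 le_n H1 H2 H3 H4.
  move: (size _) (size _) (size _) (size _) (size _) (size _) => x1 x2 x3 x4 x5 x6.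
  by lia.
rewrite sum_grs_u; last by rewrite (leq_trans size_gf) ?leq_pred.
by rewrite nth_default ?mulr0.
Qed.

(** The polynomial [vanishing_poly (S :\ i)] has size exactly [#|S|], and its [Q]-th power kills
    every term of the sum except the one at [i]. *)
Lemma sum_subset_orthogonal (S : {set 'I_n}) (Q : nat) (c : 'I_n -> F) f1 :
  (0 < Q)%N -> (forall i, c i != 0) ->
  (forall f2 : {poly F}, (size f2 <= #|S|)%N ->
     \sum_(i in S) c i * (f1 * f2 ^+ Q).[a i] = 0) <-> vanishing_poly S %| f1.
Proof.
move=> Q_gt0 c_neq0; split=> [orth | /dvd_vanishing_poly f1_S f2 _]; last first.
  by apply: big1 => i iS; rewrite hornerM f1_S // mul0r mulr0.
apply/dvd_vanishing_poly => i iS; have := orth (vanishing_poly (S :\ i)).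
rewrite size_vanishing_poly [#|S|](cardsD1 i) iS => /(_ (leqnn _))/eqP.
rewrite (bigD1 i) //= big1 ?addr0 => [|j /andP[jS ji]].
  rewrite hornerM horner_exp !mulf_eq0 (negPf (c_neq0 i)) expf_eq0 Q_gt0 /=.
  by rewrite vanishing_poly_eq0 !inE eqxx orbF => /eqP.
have /eqP vj0 : (vanishing_poly (S :\ i)).[a j] == 0.
  by rewrite vanishing_poly_eq0 !inE ji.
by rewrite hornerM horner_exp vj0 expr0n eqn0Ngt Q_gt0 !mulr0.
Qed.

(** Twisting only changes the column multipliers, so the code stays a GRS code, hence MDS, while the
    inner product is altered at the positions in [S] alone. *)
Definition twist (S : {set 'I_n}) (alpha : F) (v : 'I_n -> F) (i : 'I_n) : F :=
  if i \in S then alpha * v i else v i.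

Lemma twist_neq0 S alpha v :
  alpha != 0 -> (forall i, v i != 0) -> forall i, twist S alpha v i != 0.
Proof. by move=> ? v_neq0 i; rewrite /twist; case: ifP; rewrite // mulf_neq0. Qed.

(** As the untwisted total is zero, the part outside [S] is minus the part over [S]. *)
Lemma sum_twist S alpha v N (x : 'I_n -> F) :
  \sum_i v i ^+ N * x i = 0 ->
  \sum_i twist S alpha v i ^+ N * x i =
  (alpha ^+ N - 1) * \sum_(i in S) v i ^+ N * x i.
Proof.
rewrite !(bigID (mem S) predT) /= => /eqP; rewrite addrC addr_eq0 => /eqP sumN.
rewrite mulrBl mul1r -sumN mulr_sumr; congr (_ + _).
  by apply: eq_bigr => i iS; rewrite /twist iS exprMn mulrA.
by apply: eq_bigr => i iS; rewrite /twist (negPf iS).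
Qed.

(** * Codes with a hull of prescribed dimension *)

Lemma exists_set_card s : (s <= n)%N -> exists S : {set 'I_n}, #|S| = s.
Proof.
rewrite -[n in (_ <= n)%N]card_ord => /card_geqP[r [uniq_r size_r _]].
by exists [set i in r]; rewrite cardsE (card_uniqP uniq_r).
Qed.

Lemma GRS_hull_code (p e k l : nat) (v : 'I_n -> F) (alpha : F) :
  (0 < p)%N -> (0 < k <= n)%N -> (l <= k)%N -> (forall i, v i != 0) ->
  alpha != 0 -> alpha ^+ (p ^ e + 1) != 1 ->
  (forall f1 f2 : {poly F}, (size f1 <= k)%N -> (size f2 <= k)%N ->
     \sum_i v i ^+ (p ^ e + 1) * (f1 * f2 ^+ (p ^ e)).[a i] = 0) ->
  exists C : {vspace 'rV[F]_n},
    [/\ \dim C = k, is_MDS C & \dim (galois_hull p e C) = l].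
Proof.
move=> p_gt0 /andP[k_gt0 le_kn] le_lk v_neq0 alpha_neq0 alpha_neq1 orth.
(* The multiples of a polynomial of degree k - l among those of degree below k form a space of
   dimension l. *)
have [S card_S] := @exists_set_card (k - l) (leq_trans (leq_subr l k) le_kn).
have tw_neq0 := twist_neq0 S alpha_neq0 v_neq0.
set w := twist S alpha v in tw_neq0.
have zeros f : [set i | grs_word a w f 0 i == 0] = [set i | f.[a i] == 0].
  by apply/setP => i; rewrite !inE mxE mulf_eq0 (negPf (tw_neq0 i)).
have few_zeros (f : {poly F}) : (size f <= k)%N -> f != 0 ->
    (#|[set i | grs_word a w f 0%R i == 0%R]| < k)%N.
  by move=> size_f /card_zeros_lt lt_f; rewrite zeros (leq_trans lt_f).
have w_inj (f : {poly F}) : (size f <= k)%N -> grs_word a w f = 0 -> f = 0.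
  move=> size_f wf0; apply/eqP; apply: contraT => /(few_zeros f size_f).
  rewrite wf0 (_ : [set i | _] = setT) ?cardsT ?card_ord ?ltnNge ?le_kn //.
  by apply/setP => i; rewrite !inE mxE eqxx.
exists (GRS k a w); split.
- exact: (dim_limg_npoly (@grs_word_is_linear F n a w)).
- apply: MDS_limg_npoly (@grs_word_is_linear F n a w) _ _ few_zeros _.
    by rewrite k_gt0.
  (* A polynomial with k - 1 prescribed zeros yields a word of minimum weight. *)
  have [T card_T] := @exists_set_card (k - 1) (leq_trans (leq_subr 1 k) le_kn).
  exists (vanishing_poly T); split.
  + by rewrite size_vanishing_poly card_T subn1 prednK.
  + exact/monic_neq0/vanishing_poly_monic.
  + rewrite zeros (_ : [set i | _] = T) ?card_T ?subnK //.
    by apply/setP => i; rewrite inE vanishing_poly_eq0.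
apply: (dim_galois_hull (K := k) (@grs_word_is_linear F n a w)
          (vanishing_poly_monic S)) => //.
  by rewrite size_vanishing_poly card_S addSn subnK.
move=> f1 size_f1; rewrite size_f1 andbT.
have innerE (f2 : {poly F}) : (size f2 <= k)%N ->
    (galois_inner p e (grs_word a w f1) (grs_word a w f2) == 0) =
    (\sum_(i in S) v i ^+ (p ^ e + 1) * (f1 * f2 ^+ (p ^ e)).[a i] == 0).
  move=> size_f2; rewrite galois_inner_grs sum_twist ?orth // mulf_eq0.
  by rewrite subr_eq0 (negPf alpha_neq1).
have vQ_neq0 i : v i ^+ (p ^ e + 1) != 0 by rewrite expf_neq0.
have Q_gt0 : (0 < p ^ e)%N by rewrite expn_gt0 p_gt0.
split=> [orth1 | /dvd_vanishing_poly f1_S f2 size_f2].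
  apply/(sum_subset_orthogonal _ _ Q_gt0 vQ_neq0) => f2 size_f2.
  have le_f2 : (size f2 <= k)%N by rewrite (leq_trans size_f2) // card_S leq_subr.
  by apply/eqP; rewrite -innerE // orth1.
apply/eqP; rewrite innerE //; apply/eqP/big1 => i iS.
by rewrite hornerM f1_S // mul0r mulr0.
Qed.

(** Orthogonality is tested in two rounds. Polynomials [f2] of size at most k - 1 have last
    coordinate 0, and force [vanishing_poly S] to divide [f1]. The sum over [S] then vanishes for
    every [f2], so testing against x^(k-1) leaves only the last coordinate of [f1], which must be
    0. *)
Lemma GRS_inf_hull_code (p e k l : nat) (v : 'I_n -> F) (alpha : F) :
  (0 < p)%N -> (0 < k <= n)%N -> (l < k)%N -> (forall i, v i != 0) ->
  alpha != 0 -> alpha ^+ (p ^ e + 1) != 1 ->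
  (forall f1 f2 : {poly F}, (size f1 <= k)%N -> (size f2 <= k)%N ->
     \sum_i v i ^+ (p ^ e + 1) * (f1 * f2 ^+ (p ^ e)).[a i] = 0) ->
  exists C : {vspace 'rV[F]_(n + 1)},
    [/\ \dim C = k, is_MDS C & \dim (galois_hull p e C) = l].
Proof.
move=> p_gt0 /andP[k_gt0 le_kn] lt_lk v_neq0 alpha_neq0 alpha_neq1 orth.
have le_s : (k - 1 - l <= n)%N by rewrite -subnDA (leq_trans (leq_subr _ k) le_kn).
have [S card_S] := exists_set_card le_s.
have tw_neq0 := twist_neq0 S alpha_neq0 v_neq0.
set w := twist S alpha v in tw_neq0.
have zeros (f : {poly F}) : #|[set i | grs_inf_word k a w f 0%R i == 0%R]| =
    (#|[set i | f.[a i] == 0%R]| + (f`_k.-1 == 0)%R)%N.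
  rewrite -!sum1_card !big_mkcond /= big_split_ord /= big_ord1 !inE.
  rewrite row_mxEr mxE; congr (_ + _)%N; rewrite [RHS]big_mkcond /=.
  apply: eq_bigr => i _; rewrite !inE row_mxEl mxE mulf_eq0.
  by rewrite (negPf (tw_neq0 i)).
have few_zeros (f : {poly F}) : (size f <= k)%N -> f != 0 ->
    (#|[set i | grs_inf_word k a w f 0%R i == 0%R]| < k)%N.
  move=> size_f f_neq0; have lt_f := card_zeros_lt f_neq0; rewrite zeros.
  (* A zero last coordinate lowers the size of [f] below [k], which makes up for the extra zero. *)
  have [f_k|_] := eqVneq; last by rewrite addn0 (leq_trans lt_f).
  rewrite addn1 (leq_ltn_trans lt_f) // ltn_neqAle size_f andbT.
  apply: contra_neq f_neq0 => size_fk.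
  by apply/eqP; rewrite -lead_coef_eq0 lead_coefE size_fk f_k.
have w_inj (f : {poly F}) : (size f <= k)%N -> grs_inf_word k a w f = 0 -> f = 0.
  move=> size_f wf0; apply/eqP; apply: contraT => /(few_zeros f size_f).
  rewrite wf0 (_ : [set i | _] = setT) ?cardsT ?card_ord.
    by rewrite ltnNge (leq_trans le_kn) ?leq_addr.
  by apply/setP => i; rewrite !inE mxE eqxx.
have w_lin := @grs_inf_word_is_linear F n k a w.
exists (GRS_inf k a w); split.
- exact: (dim_limg_npoly w_lin).
- apply: MDS_limg_npoly w_lin _ _ few_zeros _.
    by rewrite k_gt0 (leq_trans le_kn) ?leq_addr.
  have [T card_T] := @exists_set_card (k - 1) (leq_trans (leq_subr 1 k) le_kn).
  exists (vanishing_poly T); split.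
  + by rewrite size_vanishing_poly card_T subn1 prednK.
  + exact/monic_neq0/vanishing_poly_monic.
  + rewrite zeros (_ : [set i | _] = T) ?card_T.
      by rewrite addnAC subnK ?leq_addr.
    by apply/setP => i; rewrite inE vanishing_poly_eq0.
apply: (dim_galois_hull (K := k.-1) w_lin (vanishing_poly_monic S)) => //.
- by rewrite size_vanishing_poly card_S; lia.
- by rewrite leq_pred.
move=> f1 size_f1.
have innerE (f2 : {poly F}) : (size f2 <= k)%N ->
    galois_inner p e (grs_inf_word k a w f1) (grs_inf_word k a w f2) =
    (alpha ^+ (p ^ e + 1) - 1) *
    (\sum_(i in S) v i ^+ (p ^ e + 1) * (f1 * f2 ^+ (p ^ e)).[a i]) +
    f1`_k.-1 * f2`_k.-1 ^+ (p ^ e).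
  by move=> size_f2; rewrite galois_inner_grs_inf sum_twist ?orth.
have vQ_neq0 i : v i ^+ (p ^ e + 1) != 0 by rewrite expf_neq0.
have Q_gt0 : (0 < p ^ e)%N by rewrite expn_gt0 p_gt0.
have sum_S (f2 : {poly F}) : vanishing_poly S %| f1 ->
    \sum_(i in S) v i ^+ (p ^ e + 1) * (f1 * f2 ^+ (p ^ e)).[a i] = 0.
  move=> /dvd_vanishing_poly f1_S; apply: big1 => i iS.
  by rewrite hornerM f1_S // mul0r mulr0.
split=> [orth1 | /andP[dvd_f1 size_f1' f2 size_f2]]; last first.
  by rewrite innerE // sum_S // nth_default // mulr0 mul0r addr0.
have dvd_f1 : vanishing_poly S %| f1.
  apply/(sum_subset_orthogonal _ _ Q_gt0 vQ_neq0) => f2 size_f2.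
  have lt_f2 : (size f2 <= k.-1)%N.
    by rewrite (leq_trans size_f2) // card_S subn1 leq_subr.
  have le_f2 : (size f2 <= k)%N by rewrite (leq_trans lt_f2) ?leq_pred.
  move/eqP: (orth1 f2 le_f2).
  rewrite innerE // [f2`_k.-1]nth_default // expr0n eqn0Ngt Q_gt0 mulr0 addr0.
  by rewrite mulf_eq0 subr_eq0 (negPf alpha_neq1) => /eqP.
rewrite dvd_f1 /=.
have size_X : (size ('X^(k.-1) : {poly F})%R <= k)%N by rewrite size_polyXn prednK.
have := orth1 _ size_X; rewrite innerE // sum_S // mulr0 add0r coefXn eqxx.
rewrite expr1n mulr1 => f1_k; apply/leq_sizeP => j.
rewrite leq_eqVlt => /predU1P[<- //|lt_j].
by rewrite nth_default // (leq_trans size_f1) // -(prednK k_gt0).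
Qed.

End Evaluation.

(** * Powers of exponent p^e' + 1 in the multiplicative group of the field *)

Section Powers.
Variables (F : finFieldType) (p h e e' : nat).
Hypotheses (p_prime : prime p) (h_gt0 : (0 < h)%N) (cardF : #|F| = (p ^ h)%N).
Hypotheses (e'_gt0 : (0 < e')%N) (e_gcd : e = gcdn e' h).
Hypothesis he_even : ~~ odd (h %/ e).

(** Here [d] is gcd(p^e' + 1, q - 1), which divides p^e + 1 by [dvdn_expDn1_gcd], and [km] is a
    Bezout coefficient; the multiple of q - 1 in the Bezout relation disappears because x^(q-1) =
    1. *)
Lemma expDn1_gcd_Bezout :
  exists km d c : nat, (p ^ e + 1 = c * d)%N /\
    forall x : F, x != 0 -> x ^+ (km * (p ^ e' + 1)) = x ^+ d.
Proof.
have Q_gt0 : (0 < p ^ e' + 1)%N by rewrite addn1.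
have p_gt0 := prime_gt0 p_prime.
have [km kn bez _] := egcdnP (p ^ h - 1) Q_gt0.
have [c def_c] : exists c, (p ^ e + 1 = c * gcdn (p ^ e' + 1) (p ^ h - 1))%N.
  by apply/dvdnP/(dvdn_expDn1_gcd p_gt0 e'_gt0 e_gcd he_even);
    rewrite (dvdn_gcdl, dvdn_gcdr).
exists km, (gcdn (p ^ e' + 1) (p ^ h - 1)), c; split=> // x x_neq0.
have x1 : x ^+ (p ^ h - 1) = 1.
  apply: (mulIf x_neq0); rewrite -exprSr -addn1 subnK ?expn_gt0 ?p_gt0 //.
  by rewrite -cardF expf_card mul1r.
by rewrite bez exprD mulnC exprM x1 expr1n mul1r.
Qed.

Lemma exists_root_expDn1 (x : F) :
  x != 0 -> exists2 y : F, y != 0 & y ^+ (p ^ e' + 1) = x ^+ (p ^ e + 1).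
Proof.
have [km [d [c [-> xd]]]] := expDn1_gcd_Bezout => x_neq0.
exists (x ^+ (km * c)); first by rewrite expf_neq0.
by rewrite -exprM mulnAC exprM xd // -exprM mulnC.
Qed.

(** Otherwise the Bezout relation gives x^d = 1, hence x^(p^e + 1) = 1, for all q - 1 nonzero x.
    This is more roots than the exponent allows, since [h / e] even gives p^(2e) <= q. *)
Lemma exists_expDn1_neq1 :
  (5 <= p ^ h)%N -> exists2 x : F, x != 0 & x ^+ (p ^ e' + 1) != 1.
Proof.
move=> q_ge5.
have e_gt0 : (0 < e)%N by rewrite e_gcd gcdn_gt0 e'_gt0.
have dvd_eh : (e %| h)%N by rewrite e_gcd dvdn_gcdr.
have he_gt0 : (0 < h %/ e)%N by rewrite divn_gt0 // dvdn_leq.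
have le_2eh : (e * 2 <= h)%N.
  rewrite -(divnK dvd_eh) mulnC leq_mul2r.
  by case: (h %/ e)%N he_even he_gt0 => [|[|r]] //; rewrite orbT.
have le_P2q : (p ^ e * p ^ e <= p ^ h)%N.
  by rewrite mulnn -expnM leq_exp2l ?prime_gt1.
(* Here q >= 5 excludes q = 4, where p^e + 1 = 3 = q - 1. *)
have lt_q : (p ^ e + 1 < p ^ h - 1)%N.
  move: le_P2q q_ge5; move: (p ^ e)%N (p ^ h)%N => P q; nia.
have [km [d [c [def_P xd]]]] := expDn1_gcd_Bezout.
have [/existsP[x /andP[]]|] :=
    boolP [exists x : F, (x != 0) && (x ^+ (p ^ e' + 1) != 1)]; first by exists x.
rewrite negb_exists => /forallP all1; move: lt_q; rewrite ltnNge => /negP[].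
rewrite -cardF subn1 -(cardC1 (0 : F)) cardE.
apply: max_unity_roots; rewrite ?enum_uniq ?addn1 //.
apply/allP => x; rewrite mem_enum !inE => x_neq0; apply/unity_rootP.
rewrite -addn1 def_P mulnC exprM -xd // mulnC exprM.
by have := all1 x; rewrite x_neq0 negbK => /eqP->; rewrite !expr1n.
Qed.

End Powers.

(** * The two families of MDS codes *)

Theorem theorem5 (p h : nat) (F : finFieldType) (e e' n : nat)
    (a v : 'I_n -> F)
    (p_prime : prime p) (h_gt0 : (0 < h)%N) (cardF : #|F| = (p ^ h)%N)
    (q_ge5 : (5 <= p ^ h)%N)
    (e_range : (1 <= e <= h - 1)%N) (e'_range : (1 <= e' <= h - 1)%N)
    (e_gcd : e = gcdn e' h) (he_even : ~~ odd (h %/ e))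
    (n_gt0 : (0 < n)%N) (a_inj : injective a) (v_neq0 : forall i, v i != 0) :
  (forall m : nat,
     (GRS m a v <= galois_dual p e (GRS m a v))%VS ->
     (exists g : {poly F}, admissible_poly p e m a v g) /\
     (forall g : {poly F}, admissible_poly p e m a v g ->
      forall k l : nat,
        (1 <= k <= (p ^ e' + n - 1 - (size g).-1) %/ (p ^ e' + 1))%N ->
        (0 <= l <= k)%N ->
        exists C : {vspace 'rV[F]_n},
          [/\ \dim C = k, is_MDS C & \dim (galois_hull p e' C) = l]))
  /\
  (forall m : nat,
     (2 <= m)%N ->
     (GRS_inf m a v <= galois_dual p e (GRS_inf m a v))%VS ->
     (exists g : {poly F}, admissible_poly p e m a v g) /\
     (forall g : {poly F}, admissible_poly p e m a v g ->
      forall k l : nat,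
        (1 <= k <= (p ^ e' + n - 1 - (size g).-1) %/ (p ^ e' + 1))%N ->
        (0 <= l <= k - 1)%N ->
        exists C : {vspace 'rV[F]_(n + 1)},
          [/\ \dim C = k, is_MDS C & \dim (galois_hull p e' C) = l])).
Proof.
have e'_gt0 : (0 < e')%N by case/andP: e'_range.
have [alpha alpha_neq0 alpha_neq1] :=
  exists_expDn1_neq1 p_prime h_gt0 cardF e'_gt0 e_gcd he_even q_ge5.
have /fin_all_exists2[w w_neq0 w_v] i :
    exists2 y : F, y != 0 & y ^+ (p ^ e' + 1) = v i ^+ (p ^ e + 1).
  exact: exists_root_expDn1 p_prime cardF e'_gt0 e_gcd he_even _ (v_neq0 i).
(* Clearing the quotient gives k(Q + 1) <= Q + n - 1 - deg g with Q = p^e'. As k >= 1 the right side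
   is positive, so its subtractions do not truncate. *)
have bounds m g k : admissible_poly p e m a v g ->
    (1 <= k <= (p ^ e' + n - 1 - (size g).-1) %/ (p ^ e' + 1))%N ->
    ((size g).-1 + (k - 1) * (p ^ e' + 1) + 2 <= n)%N /\ (0 < k <= n)%N.
  move=> _ /andP[k_gt0]; rewrite leq_divRL ?addn1 // k_gt0 /= -addn1.
  by case: k k_gt0 => // k _; move: (p ^ e')%N (size g) => Q s; nia.
have orth m g k : admissible_poly p e m a v g ->
    (1 <= k <= (p ^ e' + n - 1 - (size g).-1) %/ (p ^ e' + 1))%N ->
    forall f1 f2 : {poly F}, (size f1 <= k)%N -> (size f2 <= k)%N ->
     \sum_i w i ^+ (p ^ e' + 1) * (f1 * f2 ^+ (p ^ e')).[a i] = 0.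
  move=> g_adm /(bounds m g k g_adm)[le_n _] f1 f2.
  (* By the choice of [w], the same [g] and [lambda] are admissible for e' and [w]. *)
  apply: (sum_admissible_eq0 (p := p) (e := e') (m := m) a_inj _ le_n).
  case: g_adm => g_monic size_g [la la0 la_v]; split=> //.
  by exists la => // i; rewrite la_v w_v.
have p_gt0 := prime_gt0 p_prime.
split=> [m self_orth | m m_ge2 self_orth]; split=> [|g g_adm k l k_range /= l_range].
- apply: exists_admissible_poly => // j lt_jm.
  (* The inner product of the words of x^j and 1 is the sum required by [exists_admissible_poly]. *)
  have X_in : grs_word a v 'X^j \in GRS m a v.
    by apply/GRSP; exists 'X^j; rewrite ?size_polyXn.
  have one_in : grs_word a v 1 \in GRS m a v.
    by apply/GRSP; exists 1; rewrite ?size_poly1 // (leq_ltn_trans _ lt_jm).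
  have /galois_dualP/(_ _ one_in) := subvP self_orth _ X_in.
  rewrite galois_inner_grs => sum0; rewrite -[RHS]sum0; apply: eq_bigr => i _.
  by rewrite expr1n mulr1 hornerXn.
- have [_ le_kn] := bounds m g k g_adm k_range.
  exact: (GRS_hull_code (e := e') (v := w) a_inj p_gt0 le_kn l_range w_neq0 alpha_neq0 alpha_neq1
           (orth m g k g_adm k_range)).
- apply: exists_admissible_poly => // j lt_jm.
  have X_in : grs_inf_word m a v 'X^j \in GRS_inf m a v.
    by apply/GRS_infP; exists 'X^j; rewrite ?size_polyXn.
  have one_in : grs_inf_word m a v 1 \in GRS_inf m a v.
    by apply/GRS_infP; exists 1; rewrite ?size_poly1 // (leq_ltn_trans _ lt_jm).
  have /galois_dualP/(_ _ one_in) := subvP self_orth _ X_in.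
  rewrite galois_inner_grs_inf coef1 -[m.-1 == 0]/(_ == _ :> nat).
  (* Since m >= 2, the constant 1 has no coefficient at x^(m-1), so the last coordinate contributes
     nothing. *)
  rewrite (_ : (m.-1 == 0)%N = false); last first.
    by case: m m_ge2 {self_orth lt_jm X_in one_in} => [|[]].
  rewrite expr0n eqn0Ngt expn_gt0 p_gt0 mulr0 addr0 => sum0.
  rewrite -[RHS]sum0; apply: eq_bigr => i _.
  by rewrite expr1n mulr1 hornerXn.
- have [_ le_kn] := bounds m g k g_adm k_range.
  have lt_lk : (l < k)%N by case/andP: le_kn => k_gt0 _; rewrite -(subnK k_gt0) addn1.
  exact: (GRS_inf_hull_code (e := e') (v := w) a_inj p_gt0 le_kn lt_lk w_neq0 alpha_neq0 alpha_neq1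
           (orth m g k g_adm k_range)).
Qed.
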